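(* Let $X\in\mathcal{C}_1$ be a circular graph containing at least one particle of each type, i.e. there is a vertex $u$ of $X$ with $a_1(u)=1$ and there is a vertex $v$ of $X$ with $b_1(v)=1$. For $n\in\mathbb{N}$ let $e_n=S'\left((\sqrt{\tau}\,I)^n(X)\right)$. Then $(e_n)=\Theta((\log(n)))$.
   Context: Names. Let $\mathbb{K}$ be a countable set. Names are terms $u,v ::= c \mid u.t \mid u\vee v$ with $c\in\mathbb{K}$, $t\in\{l,r\}^*$, modulo the equalities $(u\vee v).l=u$, $(u\vee v).r=v$, $u.\varepsilon=u$, $u.l\vee u.r=u$ ($\varepsilon$ the empty word). Circular graphs. An element $X$ of $\mathcal{C}_1$ consists of a finite nonempty set $V(X)$ of names such that for all $v,v'\in V(X)$ and $t,t'\in\{l,r\}^*$, $v.t=v'.t'$ implies $v=v'$ and $t=t'$; a set $E(X)$ of edges; and two bits $a_1(u),b_1(u)\in\{0,1\}$ for each vertex $u$. Each vertex $u$ has two ports $u:a$ and $u:b$; each edge has the form $\{u:b,v:a\}$, every port of every vertex belongs to exactly one edge, and the graph is connected, i.e. it is a single finite cycle (a one-vertex cycle has the single edge $\{u:b,u:a\}$). If $\{u:b,v:a\}\in E(X)$, think of $v$ as the right neighbour of $u$. The bit $a_1(u)=1$ (resp. $b_1(u)=1$) means that $u$ contains a particle about to move along port $a$ (resp. port $b$); these are the two types of particles. The number of particles of $X$ is the total number of bits equal to $1$. Entropy. For $X\in\mathcal{C}_1$ with $p$ particles, $S'(X)=\log\binom{2|V(X)|}{p}$. Step $\sqrt{\tau}$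 (each particle hops by half an edge along its port; edges become vertices and vertices become edges). $V(\sqrt{\tau}(X))=\{u.r\vee v.l \mid \{u:b,v:a\}\in E(X)\}$; for each $u\in V(X)$ with right neighbour $x$ and left neighbour $y$ (i.e. $\{u:b,x:a\},\{y:b,u:a\}\in E(X)$), there is an edge $\{y':b,x':a\}$ with $y'=y.r\vee u.l$ and $x'=u.r\vee x.l$; and the vertex $x'=u.r\vee v.l$ coming from the edge $\{u:b,v:a\}$ has bits $b_1(x')=b_1(u)$ and $a_1(x')=a_1(v)$. Step $I$. Synchronously everywhere in the graph: (split) every vertex $u$ with $a_1(u)=b_1(u)=1$ is replaced by two vertices $u.l,u.r$ joined by the edge $\{u.l:b,u.r:a\}$, where $u.l$ inherits the connection of port $a$ of $u$ and $u.r$ inherits the connection of port $b$ of $u$, with $a_1(u.l)=b_1(u.r)=1$ and $b_1(u.l)=a_1(u.r)=0$; (merge) every pair of vertices $u,v$ with $\{u:b,v:a\}\in E(X)$, $a_1(u)=b_1(v)=1$ and $b_1(u)=a_1(v)=0$ is replaced by one vertex $u\vee v$ with $a_1(u\vee v)=b_1(u\vee v)=1$, which inherits the connection of port $a$ of $u$ and the connection of port $b$ of $v$. Everything else is unchanged. These patterns do not overlap, and $I$ is an involution. $\sqrt{\tau}\,I:\mathcal{C}_1\to\mathcal{C}_1$ is the composition applying $I$ first and then $\sqrt{\tau}$. For real sequences, $(u_n)=\Theta((v_n))$ means that there exist positive reals $a,b$ and $n_0\in\mathbb{N}$ such that for all $n\ge n_0$, $a\,v_n\le u_n\le b\,v_n$.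 *)

(* Defs.v *)
From HB Require Import structures.
From mathcomp Require Import all_boot all_order all_algebra.
From mathcomp Require Import generic_quotient finmap.
From mathcomp Require Import all_classical all_reals all_analysis.

Set Implicit Arguments.
Unset Strict Implicit.
Unset Printing Implicit Defensive.

Import Order.TTheory GRing.Theory Num.Theory.

Local Open Scope quotient_scope.

Inductive dir := dl | dr.

Definition word := seq dir.

Inductive term (K : Type) :=
| Const of K
| App of term K & word
| Join of term K & term K.

HB.instance Definition _ (K : Type) := gen_eqMixin (term K).
HB.instance Definition _ (K : Type) := gen_choiceMixin (term K).

(* [te_cat] makes [u.t] the action of the word [t] on [u], so that for instance
   [(u \/ v).lr = u.r]. *)
Inductive term_eq (K : Type) : term K -> term K -> Prop :=
| te_refl u : term_eq u u
| te_sym u v : term_eq u v -> term_eq v u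
| te_trans u v w : term_eq u v -> term_eq v w -> term_eq u w
| te_app u v t : term_eq u v -> term_eq (App u t) (App v t)
| te_join u u' v v' :
    term_eq u u' -> term_eq v v' -> term_eq (Join u v) (Join u' v')
| te_joinl u v : term_eq (App (Join u v) [:: dl]) u
| te_joinr u v : term_eq (App (Join u v) [:: dr]) v
| te_nil u : term_eq (App u [::]) u
| te_eta u : term_eq (Join (App u [:: dl]) (App u [:: dr])) u
| te_cat u t s : term_eq (App (App u t) s) (App u (t ++ s)).

Definition term_eqb (K : Type) : rel (term K) := fun u v => `[< term_eq u v >].

Lemma term_eqb_refl (K : Type) : reflexive (@term_eqb K).
Proof. by move=> u; apply/asboolP; exact: te_refl. Qed.

Lemma term_eqb_sym (K : Type) : symmetric (@term_eqb K).
Proof. by move=> u v; apply/asboolP/asboolP; exact: te_sym. Qed.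

Lemma term_eqb_trans (K : Type) : transitive (@term_eqb K).
Proof.
move=> v u w /asboolP uv /asboolP vw; apply/asboolP; exact: te_trans uv vw.
Qed.

Canonical term_equiv (K : Type) : equiv_rel (term K) :=
  EquivRel (@term_eqb K) (@term_eqb_refl K) (@term_eqb_sym K)
    (@term_eqb_trans K).

Definition name (K : Type) : Type := {eq_quot (term_equiv K)}.

HB.instance Definition _ (K : Type) :=
  EqQuotient.copy (name K) {eq_quot (term_equiv K)}.
HB.instance Definition _ (K : Type) :=
  Choice.copy (name K) {eq_quot (term_equiv K)}.

Definition ncst (K : Type) (c : K) : name K := \pi_(name K) (Const c).

Definition napp (K : Type) (u : name K) (t : word) : name K :=
  \pi_(name K) (App (repr u) t).

Definition njoin (K : Type) (u v : name K) : name K :=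
  \pi_(name K) (Join (repr u) (repr v)).

Definition nl (K : Type) (u : name K) : name K := napp u [:: dl].
Definition nr (K : Type) (u : name K) : name K := napp u [:: dr].

Lemma name_eqP (K : Type) (s t : term K) :
  \pi_(name K) s = \pi_(name K) t <-> term_eq s t.
Proof. by split=> [/eqquotP/asboolP|st] //; apply/eqquotP/asboolP. Qed.

Lemma repr_pi (K : Type) (s : term K) : term_eq (repr (\pi_(name K) s)) s.
Proof. by apply/name_eqP; rewrite reprK. Qed.

Lemma napp_pi (K : Type) (s : term K) (t : word) :
  napp (\pi_(name K) s) t = \pi_(name K) (App s t).
Proof. by apply/name_eqP/te_app/repr_pi. Qed.

Lemma njoin_pi (K : Type) (s t : term K) :
  njoin (\pi_(name K) s) (\pi_(name K) t) = \pi_(name K) (Join s t).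
Proof. by apply/name_eqP; apply: te_join; exact: repr_pi. Qed.

Lemma nl_join (K : Type) (u v : name K) : nl (njoin u v) = u.
Proof.
rewrite -[u]reprK -[v]reprK njoin_pi /nl napp_pi; apply/name_eqP.
exact: te_joinl.
Qed.

Lemma nr_join (K : Type) (u v : name K) : nr (njoin u v) = v.
Proof.
rewrite -[u]reprK -[v]reprK njoin_pi /nr napp_pi; apply/name_eqP.
exact: te_joinr.
Qed.

Lemma napp_nil (K : Type) (u : name K) : napp u [::] = u.
Proof. by rewrite -[u]reprK napp_pi; apply/name_eqP; exact: te_nil. Qed.

Lemma njoin_eta (K : Type) (u : name K) : njoin (nl u) (nr u) = u.
Proof.
rewrite -[u]reprK /nl /nr !napp_pi njoin_pi; apply/name_eqP; exact: te_eta.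
Qed.

Lemma napp_cat (K : Type) (u : name K) (t s : word) :
  napp (napp u t) s = napp u (t ++ s).
Proof.
rewrite -[u]reprK [X in napp X s]napp_pi !napp_pi; apply/name_eqP; exact: te_cat.
Qed.

Local Close Scope quotient_scope.
Local Open Scope fset_scope.

(* The pair [(u, v)] in [edges X] stands for the edge {u:b, v:a}; [abits X]
   (resp. [bbits X]) is the set of the vertices [u] with a_1(u) = 1
   (resp. b_1(u) = 1). *)
Record graph (K : Type) := Graph {
  verts : {fset name K};
  edges : {fset name K * name K};
  abits : {fset name K};
  bbits : {fset name K} }.

Definition adjacent (K : Type) (X : graph K) : rel (name K) :=
  fun u v => ((u, v) \in edges X) || ((v, u) \in edges X).

(* The set C_1 of circular graphs. *)
Record circular (K : Type) (X : graph K) : Prop := Circular {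
  circ_neq0 : verts X != fset0;
  circ_names : forall (u v : name K) (t s : word),
    u \in verts X -> v \in verts X -> napp u t = napp v s -> u = v /\ t = s;
  circ_edges : forall e : name K * name K,
    e \in edges X -> e.1 \in verts X /\ e.2 \in verts X;
  circ_portb : forall u : name K, u \in verts X ->
    exists! e : name K * name K, e \in edges X /\ e.1 = u;
  circ_porta : forall u : name K, u \in verts X ->
    exists! e : name K * name K, e \in edges X /\ e.2 = u;
  circ_connected : forall u v : name K, u \in verts X -> v \in verts X ->
    exists2 p : seq (name K), path (adjacent X) u p & last u p = v;
  circ_abits : abits X `<=` verts X;
  circ_bbits : bbits X `<=` verts X }.

Definition nparticles (K : Type) (X : graph K) : nat :=
  (#|` abits X| + #|` bbits X|)%N.

Definition entropy (K : Type) (R : realType) (X : graph K) : R :=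
  ln ('C(2 * #|` verts X|, nparticles X)%:R)%R.

(* The vertex of the new graph coming from the edge {e.1:b, e.2:a}. *)
Definition edge_name (K : Type) (e : name K * name K) : name K :=
  njoin (nr e.1) (nl e.2).

(* An edge of the new graph comes from two consecutive edges
   {y:b, u:a} and {u:b, x:a}. *)
Definition sqrt_tau (K : Type) (X : graph K) : graph K :=
  {| verts := [fset edge_name e | e in edges X];
     edges := [fset (edge_name ef.1, edge_name ef.2)
                 | ef in edges X `*` edges X & ef.1.2 == ef.2.1];
     abits := [fset edge_name e | e in edges X & e.2 \in abits X];
     bbits := [fset edge_name e | e in edges X & e.1 \in bbits X] |}.

Definition split_verts (K : Type) (X : graph K) : {fset name K} :=
  abits X `&` bbits X.

Definition merge_pairs (K : Type) (X : graph K) :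
    {fset name K * name K} :=
  [fset e in edges X |
    [&& e.1 \in abits X, e.1 \notin bbits X,
        e.2 \in bbits X & e.2 \notin abits X]].

Definition fixed_verts (K : Type) (X : graph K) : {fset name K} :=
  [fset u in verts X |
    [&& u \notin split_verts X,
        u \notin [fset e.1 | e in merge_pairs X] &
        u \notin [fset e.2 | e in merge_pairs X]]].

(* The vertex of the new graph that inherits the connection of port [a]
   (resp. [b]) of [u]; meaningless when that port lies on the edge of a merged
   pair, which disappears. *)
Definition heir_a (K : Type) (X : graph K) (u : name K) : name K :=
  if u \in split_verts X then nl u
  else if [pick e : merge_pairs X | (val e).1 == u] is Some e
       then njoin (val e).1 (val e).2
       else u.

Definition heir_b (K : Type) (X : graph K) (u : name K) : name K :=
  if u \in split_verts X then nr u
  else if [pick e : merge_pairs X | (val e).2 == u] is Some e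
       then njoin (val e).1 (val e).2
       else u.

(* The step I: the split and merge rules applied synchronously. *)
Definition split_merge (K : Type) (X : graph K) : graph K :=
  let merged := [fset njoin e.1 e.2 | e in merge_pairs X] in
  let lhalves := [fset nl u | u in split_verts X] in
  let rhalves := [fset nr u | u in split_verts X] in
  {| verts := fixed_verts X `|` merged `|` lhalves `|` rhalves;
     edges := [fset (heir_b X e.1, heir_a X e.2)
                 | e in edges X `\` merge_pairs X]
              `|` [fset (nl u, nr u) | u in split_verts X];
     abits := (abits X `&` fixed_verts X) `|` merged `|` lhalves;
     bbits := (bbits X `&` fixed_verts X) `|` merged `|` rhalves |}.

Definition step (K : Type) (X : graph K) : graph K := sqrt_tau (split_merge X).

Definition is_Theta (R : realType) (u v : nat -> R) : Prop :=
  exists (a b : R) (n0 : nat), (0 < a)%R /\ (0 < b)%R /\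
    forall n : nat, (n0 <= n)%N -> (a * v n <= u n)%R /\ (u n <= b * v n)%R.

(* Main.v *)
Require Import Defs.
From mathcomp Require Import all_boot all_order all_algebra.
From mathcomp Require Import generic_quotient finmap.
From mathcomp Require Import all_classical all_reals all_analysis.
From mathcomp Require Import zify.

(** Growth is caused by right- and left-moving particles that meet (each meeting
    splits a vertex), shrinking by merges.  A merge at time [n + 1] can only
    involve the two particles that a merge put on one vertex at time [n], and
    each of these merges removes one vertex of the particle-free stretch behind
    the right-moving one; hence there is no merge after [|V(X)|] steps.  From
    then on particles move freely between meetings, and a new meeting occurs
    within about [|V|] steps, so [|V|] grows at least like the square root of
    the time.  It grows at most linearly, and the number [p] of particles is
    constant, so that [ln 'C(2|V|, p)] has order [ln n]. *)

Set Implicit Arguments.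
Unset Strict Implicit.
Unset Printing Implicit Defensive.

Import Order.TTheory GRing.Theory Num.Theory.

Local Open Scope fset_scope.

(** * Independent names and the invariant of the dynamics *)

Definition independent (K : Type) (V : {fset name K}) : Prop :=
  forall (u v : name K) (t s : word),
    u \in V -> v \in V -> napp u t = napp v s -> u = v /\ t = s.

(** A finite disjoint union of directed cycles: the invariant carried through both half steps.
    Incoming edges exist by finiteness ([cyc_in]); connectedness enters on the initial graph, in
    [circular_walk]. *)
Record cyclic (K : Type) (X : graph K) : Prop := Cyclic {
  cyc_names : independent (verts X);
  cyc_fst : forall u v : name K, (u, v) \in edges X -> u \in verts X;
  cyc_snd : forall u v : name K, (u, v) \in edges X -> v \in verts X;
  cyc_out : forall u : name K, u \in verts X -> exists v, (u, v) \in edges X;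
  cyc_out_uniq : forall u v w : name K,
    (u, v) \in edges X -> (u, w) \in edges X -> v = w;
  cyc_in_uniq : forall u v w : name K,
    (v, u) \in edges X -> (w, u) \in edges X -> v = w;
  cyc_a : abits X `<=` verts X;
  cyc_b : bbits X `<=` verts X }.

(** * Algebra of names *)

Section Names.
Variable K : Type.
Implicit Types (u v : name K) (t s w : word) (V W : {fset name K}).

Lemma napp_nl u t : napp (nl u) t = napp u (dl :: t).
Proof. by rewrite /nl napp_cat. Qed.

Lemma napp_nr u t : napp (nr u) t = napp u (dr :: t).
Proof. by rewrite /nr napp_cat. Qed.

Lemma napp_joinl u v t : napp (njoin u v) (dl :: t) = napp u t.
Proof. by rewrite -napp_nl nl_join. Qed.

Lemma napp_joinr u v t : napp (njoin u v) (dr :: t) = napp v t.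
Proof. by rewrite -napp_nr nr_join. Qed.

(* [code n x u w] says that the new name [n.x] is the word [w] applied to the
   old name [u]; independence of the new names is that of these codes. *)
Lemma independent_recode V W (code : name K -> dir -> name K -> word -> Prop) :
  independent V ->
  (forall n x, n \in W -> exists u w,
     [/\ code n x u w, u \in V & forall t, napp n (x :: t) = napp u (w ++ t)]) ->
  (forall n m x y u w (w' : word) t s, code n x u w -> code m y u w' ->
     w ++ t = w' ++ s -> [/\ n = m, x = y & w = w']) ->
  independent W.
Proof.
move=> indV codeW codeU.
have cons n m x y t s : n \in W -> m \in W ->
    napp n (x :: t) = napp m (y :: s) -> [/\ n = m, x = y & t = s].
  move=> nW mW; have [u [w [cu uV ->]]] := codeW n x nW.
  have [v [w' [cv vV ->]]] := codeW m y mW.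
  move=> /(indV _ _ _ _ uV vV)[uv wt]; rewrite -uv in cv.
  have [-> -> ww'] := codeU _ _ _ _ _ _ _ _ _ cu cv wt.
  by split=> //; move: wt; rewrite ww' => {cu cv ww'}; elim: w' => //= a w' IH [] /IH.
(* Appending [dl] and then [dr] to both sides would force [y] to be both letters. *)
have nilP n m y s : n \in W -> m \in W -> napp n [::] <> napp m (y :: s).
  move=> nW mW nm.
  have ext x : napp n [:: x] = napp m (y :: s ++ [:: x]).
    by rewrite -(cat0s [:: x]) -napp_cat nm napp_cat.
  have [_ dly _] := cons _ _ _ _ _ _ nW mW (ext dl).
  by have [_] := cons _ _ _ _ _ _ nW mW (ext dr); rewrite -dly.
move=> n m [|x t] [|y s] nW mW nm.
- have : napp n [:: dl] = napp m [:: dl].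
    by rewrite -(cat0s [:: dl]) -!napp_cat nm.
  by case/(cons _ _ _ _ _ _ nW mW).
- by case: (nilP _ _ _ _ nW mW nm).
- by case: (nilP _ _ _ _ mW nW (esym nm)).
- by have [-> -> ->] := cons _ _ _ _ _ _ nW mW nm.
Qed.

Lemma nl_inj V u v : independent V -> u \in V -> v \in V -> nl u = nl v -> u = v.
Proof. by move=> indV uV vV /(indV _ _ _ _ uV vV)[]. Qed.

Lemma nr_inj V u v : independent V -> u \in V -> v \in V -> nr u = nr v -> u = v.
Proof. by move=> indV uV vV /(indV _ _ _ _ uV vV)[]. Qed.

Lemma nl_neq_nr V u v : independent V -> u \in V -> v \in V -> nl u <> nr v.
Proof. by move=> indV uV vV /(indV _ _ _ _ uV vV)[]. Qed.

Lemma nl_neq V u v : independent V -> u \in V -> v \in V -> nl u <> v.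
Proof. by move=> indV uV vV; rewrite -[X in _ <> X]napp_nil => /(indV _ _ _ _ uV vV)[]. Qed.

Lemma nr_neq V u v : independent V -> u \in V -> v \in V -> nr u <> v.
Proof. by move=> indV uV vV; rewrite -[X in _ <> X]napp_nil => /(indV _ _ _ _ uV vV)[]. Qed.

Lemma njoin_neq V u v (w : name K) : independent V -> u \in V -> w \in V -> njoin u v <> w.
Proof.
by move=> indV uV wV juv; apply: (nl_neq indV wV uV); rewrite -juv nl_join.
Qed.

Lemma njoin_inj u v u' v' : njoin u v = njoin u' v' -> u = u' /\ v = v'.
Proof.
move=> h; split; first by rewrite -(nl_join u v) h nl_join.
by rewrite -(nr_join u v) h nr_join.
Qed.

Lemma njoin_neq_nl V u v (w : name K) : independent V -> u \in V -> w \in V ->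
  njoin u v <> nl w.
Proof.
move=> indV uV wV /(congr1 (fun n => napp n [:: dl])).
by rewrite napp_joinl napp_nl => /(indV _ _ _ _ uV wV)[].
Qed.

Lemma njoin_neq_nr V u v (w : name K) : independent V -> u \in V -> w \in V ->
  njoin u v <> nr w.
Proof.
move=> indV uV wV /(congr1 (fun n => napp n [:: dl])).
by rewrite napp_joinl napp_nr => /(indV _ _ _ _ uV wV)[].
Qed.

End Names.

(** * Directed walks around cycles *)

Fixpoint walk (K : Type) (X : graph K) (k : nat) (u v : name K) : Prop :=
  if k is k'.+1 then exists2 w, (u, w) \in edges X & walk X k' w v else u = v.

Section Cycle.
Variables (K : Type) (X : graph K).
Hypothesis cX : cyclic X.
Implicit Types u v w : name K.

Lemma walk_cat k l u v w : walk X k u v -> walk X l v w -> walk X (k + l)%N u w.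
Proof.
by elim: k u => [u ->|k IHk u [x ux xv vw]] //=; exists x => //; exact: IHk.
Qed.

(** Stated on the finite type of vertices, so that [order] and [finv] apply; injectivity is
    uniqueness of incoming edges. *)
Lemma successor : exists f : verts X -> verts X,
  injective f /\ forall x, (val x, val (f x)) \in edges X.
Proof.
have /choice[f fP] : forall x : verts X, exists y : verts X,
    (val x, val y) \in edges X.
  move=> x; have [v xv] := cyc_out cX (valP x).
  by exists (FSetSub (cyc_snd cX xv)).
exists f; split=> // x y fxy; apply: val_inj; have := fP y; rewrite -fxy.
exact: cyc_in_uniq (fP x).
Qed.

(* The successor map permutes the finite set of vertices, so one goes around
   the cycle from [v] back to its predecessor [u]. *)
Lemma walk_back u v : (u, v) \in edges X ->
  exists2 k, k < #|` verts X| & walk X k v u.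
Proof.
move=> uv; have [f [injf fP]] := successor.
pose y : verts X := FSetSub (cyc_snd cX uv).
have iterP k (x : verts X) : walk X k (val x) (val (iter k f x)).
  elim: k x => //= k IHk x; exists (val (f x)); first exact: fP.
  by rewrite -/(iter k.+1 f x) iterSr; exact: IHk.
exists (order f y).-1.
  rewrite cardfE prednK ?order_gt0 //; exact: max_card.
have := fP (finv f y); rewrite (f_finv injf) => /(cyc_in_uniq cX) /(_ uv) <-.
exact: (iterP _ y).
Qed.

(** An injective self-map of a finite set is onto. *)
Lemma cyc_in u : u \in verts X -> exists w, (w, u) \in edges X.
Proof.
move=> uV; have [f [injf fP]] := successor.
by exists (val (finv f (FSetSub uV))); have := fP (finv f (FSetSub uV)); rewrite (f_finv injf).
Qed.

(** Each vertex has exactly one outgoing edge. With [card_snd], this transports counts of vertices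
    and particles to the edges, which [sqrt_tau] turns into vertices. *)
Lemma card_fst (A : {fset name K}) : A `<=` verts X ->
  #|` [fset e in edges X | e.1 \in A] | = #|` A|.
Proof.
move=> AV; transitivity #|` [fset e.1 | e in [fset e in edges X | e.1 \in A]]|.
  apply/esym/card_in_imfset => -[u v] [u' v']; rewrite !inE /= => /andP[uv _] /andP[uv' _] uu'.
  by rewrite uu' in uv *; rewrite (cyc_out_uniq cX uv uv').
congr (#|` _|); apply/fsetP => u; apply/imfsetP/idP => [[e]|uA] /=.
  by rewrite !inE => /andP[_ eA] ->.
have [v uv] := cyc_out cX (fsubsetP AV _ uA).
by exists (u, v); rewrite // !inE uv.
Qed.

Lemma card_snd (A : {fset name K}) : A `<=` verts X ->
  #|` [fset e in edges X | e.2 \in A] | = #|` A|.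
Proof.
move=> AV; transitivity #|` [fset e.2 | e in [fset e in edges X | e.2 \in A]]|.
  apply/esym/card_in_imfset => -[u v] [u' v']; rewrite !inE /= => /andP[uv _] /andP[uv' _] vv'.
  by rewrite vv' in uv *; rewrite (cyc_in_uniq cX uv uv').
congr (#|` _|); apply/fsetP => u; apply/imfsetP/idP => [[e]|uA] /=.
  by rewrite !inE => /andP[_ eA] ->.
have [v uv] := cyc_in (fsubsetP AV _ uA).
by exists (v, u); rewrite // !inE uv.
Qed.

End Cycle.

Lemma circular_cyclic (K : Type) (X : graph K) : circular X -> cyclic X.
Proof.
case=> _ indX edgeX outX inX _ aX bX; split=> //.
- by move=> u v /edgeX[].
- by move=> u v /edgeX[].
- by move=> u /outX[[w v] [[wv /= <-] _]]; exists v.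
- move=> u v w uv uw; have [uV _] := edgeX _ uv.
  have [e [_ eU]] := outX _ uV.
  by have := eU _ (conj uw erefl); rewrite (eU _ (conj uv erefl)) => -[].
- move=> u v w uv uw; have [_ uV] := edgeX _ uv.
  have [e [_ eU]] := inX _ uV.
  by have := eU _ (conj uw erefl); rewrite (eU _ (conj uv erefl)) => -[].
Qed.

(** The path given by connectedness may follow edges backwards; [walk_back] replaces each of these
    by a tour of the cycle. *)
Lemma circular_walk (K : Type) (X : graph K) (u v : name K) :
  circular X -> u \in verts X -> v \in verts X -> exists k, walk X k u v.
Proof.
move=> hX uV vV; have cX := circular_cyclic hX.
have [p pathp <-] := circ_connected hX uV vV.
elim: p u {uV} pathp => [|w p IHp] u /=; first by exists 0.
case/andP=> uw /IHp[k wk].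
have [l ul] : exists l, walk X l u w.
  by case/orP: uw => [uw|/(walk_back cX)[l _ wl]]; [exists 1; exists w | exists l].
by exists (l + k)%N; exact: walk_cat ul wk.
Qed.

(** * The half step that exchanges edges and vertices *)

Section SqrtTau.
Variables (K : Type) (X : graph K).
Hypothesis cX : cyclic X.
Implicit Types (u v : name K) (e f : name K * name K).

Lemma edge_name_inj e f : e \in edges X -> f \in edges X ->
  edge_name e = edge_name f -> e = f.
Proof.
case: e f => [u v] [u' v'] uv uv' /njoin_inj[] /=.
move=> /(nr_inj (cyc_names cX) (cyc_fst cX uv) (cyc_fst cX uv')) ->.
by move=> /(nl_inj (cyc_names cX) (cyc_snd cX uv) (cyc_snd cX uv')) ->.
Qed.

Lemma sqrt_tau_vertsP n :
  reflect (exists2 e, e \in edges X & n = edge_name e) (n \in verts (sqrt_tau X)).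
Proof. exact: imfsetP. Qed.

Lemma sqrt_tau_edgesP n m :
  reflect (exists u v w, [/\ (u, v) \in edges X, (v, w) \in edges X,
             n = edge_name (u, v) & m = edge_name (v, w)])
          ((n, m) \in edges (sqrt_tau X)).
Proof.
apply: (iffP (imfsetP _ _ _ _)) => /= [[[[u v] [v' w]]]|[u [v [w [uv vw -> ->]]]]].
  by rewrite !inE /= => /andP[/andP[uv vw] /eqP vv'] [-> ->]; subst v'; exists u, v, w.
by exists ((u, v), (v, w)); rewrite // !inE uv vw /=.
Qed.

Lemma sqrt_tau_aP e : e \in edges X ->
  (edge_name e \in abits (sqrt_tau X)) = (e.2 \in abits X).
Proof.
move=> eX; apply/imfsetP/idP => /= [[f]|ea]; last by exists e; rewrite // !inE eX.
by rewrite !inE => /andP[fX fa] /(edge_name_inj eX fX) ->.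
Qed.

Lemma sqrt_tau_bP e : e \in edges X ->
  (edge_name e \in bbits (sqrt_tau X)) = (e.1 \in bbits X).
Proof.
move=> eX; apply/imfsetP/idP => /= [[f]|ea]; last by exists e; rewrite // !inE eX.
by rewrite !inE => /andP[fX fa] /(edge_name_inj eX fX) ->.
Qed.

Lemma sqrt_tau_cyclic : cyclic (sqrt_tau X).
Proof.
split.
(* The left half of an edge name is [u.r] and the right half is [v.l]; the letter of the code tells
   which half is read, and the old vertex then determines the edge. *)
- pose code n x u w := exists2 e, e \in edges X /\ n = edge_name e &
    (x = dl /\ u = e.1 /\ w = [:: dr]) \/ (x = dr /\ u = e.2 /\ w = [:: dl]).
  apply: (independent_recode (code := code) (cyc_names cX)).
    move=> n x /sqrt_tau_vertsP[[u v] uv ->]; case: x.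
      exists u, [:: dr]; split; last by move=> t; rewrite napp_joinl napp_nr.
        by exists (u, v); [| left].
      exact: cyc_fst uv.
    exists v, [:: dl]; split; last by move=> t; rewrite napp_joinr napp_nl.
      by exists (u, v); [| right].
    exact: cyc_snd uv.
  move=> n m x y u w w' t s [[v1 v2] [vX ->] vP] [[v1' v2'] [vX' ->] vP'].
  case: vP vP' => [[-> [-> ->]]|[-> [-> ->]]] [[-> [/= h ->]]|[-> [/= h ->]]] //.
    by subst v1'; rewrite (cyc_out_uniq cX vX vX').
  by subst v2'; rewrite (cyc_in_uniq cX vX vX').
- by move=> n m /sqrt_tau_edgesP[u [v [w [uv vw -> _]]]]; apply/sqrt_tau_vertsP; exists (u, v).
- by move=> n m /sqrt_tau_edgesP[u [v [w [uv vw _ ->]]]]; apply/sqrt_tau_vertsP; exists (v, w).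
- move=> n /sqrt_tau_vertsP[[u v] uv ->].
  have [w vw] := cyc_out cX (cyc_snd cX uv).
  by exists (edge_name (v, w)); apply/sqrt_tau_edgesP; exists u, v, w.
- move=> n m m' /sqrt_tau_edgesP[u [v [w [uv vw -> ->]]]].
  move=> /sqrt_tau_edgesP[u' [v' [w' [uv' vw' /(edge_name_inj uv uv')[_ vv'] ->]]]].
  by subst v'; rewrite (cyc_out_uniq cX vw vw').
- move=> n m m' /sqrt_tau_edgesP[u [v [w [uv vw -> ->]]]].
  move=> /sqrt_tau_edgesP[u' [v' [w' [uv' vw' -> /(edge_name_inj vw vw')[vv' _]]]]].
  by subst v'; rewrite (cyc_in_uniq cX uv uv').
- apply/fsubsetP => n /imfsetP[e] /=; rewrite !inE => /andP[eX _ ->].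
  by apply/sqrt_tau_vertsP; exists e.
- apply/fsubsetP => n /imfsetP[e] /=; rewrite !inE => /andP[eX _ ->].
  by apply/sqrt_tau_vertsP; exists e.
Qed.

Lemma card_sqrt_tau_verts : #|` verts (sqrt_tau X)| = #|` verts X|.
Proof.
rewrite card_in_imfset /=; last by move=> e f; exact: edge_name_inj.
rewrite -(card_fst cX (fsubset_refl _)); congr (#|` _|).
apply/fsetP => -[u v]; rewrite !inE /=.
by case: (boolP (_ \in edges X)) => // /(cyc_fst cX) ->.
Qed.

Lemma nparticles_sqrt_tau : nparticles (sqrt_tau X) = nparticles X.
Proof.
have card_tau (P : pred (name K * name K)) :
    #|` [fset edge_name e | e in edges X & P e]| = #|` [fset e in edges X | P e]|.
  transitivity #|` [fset edge_name e | e in [fset e in edges X | P e]]|.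
    congr (#|` _|); apply/fsetP => n; apply/imfsetP/imfsetP => /= -[e];
      by rewrite !inE => eX ->; exists e; rewrite ?inE.
  apply/card_in_imfset => e f; rewrite !inE => /andP[eX _] /andP[fX _].
  exact: edge_name_inj.
by rewrite /nparticles !card_tau (card_snd cX (cyc_a cX)) (card_fst cX (cyc_b cX)).
Qed.

(** The [k + 1] edges of the walk become [k + 1] vertices, hence [k] edges. The first of them
    receives the b-bit of [u] and the last the a-bit of [v]. *)
Lemma sqrt_tau_walk k u v : walk X k.+1 u v -> exists x y,
  [/\ (u, x) \in edges X, (y, v) \in edges X &
      walk (sqrt_tau X) k (edge_name (u, x)) (edge_name (y, v))].
Proof.
elim: k u => [|k IHk] u [w uw]; first by move=> <-; exists w, u.
move=> /IHk[x [y [wx yv xy]]]; exists w, y; split=> //.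
by exists (edge_name (w, x)) => //; apply/sqrt_tau_edgesP; exists u, w, x.
Qed.

End SqrtTau.

(** * The split and merge step *)

Lemma card_fsetU_disjoint (T : choiceType) (A B : {fset T}) :
  (forall x, x \in A -> x \in B -> False) -> #|` A `|` B| = (#|` A| + #|` B|)%N.
Proof.
move=> AB; rewrite cardfsU; suff -> : A `&` B = fset0 by rewrite cardfs0 subn0.
by apply/fsetP => x; rewrite !inE; apply/andP => -[/AB].
Qed.

Section SplitMerge.
Variables (K : Type) (X : graph K).
Hypothesis cX : cyclic X.
Implicit Types (u v n m : name K) (e f : name K * name K).

Let indX := cyc_names cX.
Let aV u (ua : u \in abits X) : u \in verts X := fsubsetP (cyc_a cX) u ua.

Lemma merge_pairsE u v : ((u, v) \in merge_pairs X) =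
  [&& (u, v) \in edges X, u \in abits X, u \notin bbits X, v \in bbits X
    & v \notin abits X].
Proof. by rewrite !inE. Qed.

Lemma split_vertsE u : (u \in split_verts X) = (u \in abits X) && (u \in bbits X).
Proof. by rewrite !inE. Qed.

Lemma merge_edge u v : (u, v) \in merge_pairs X -> (u, v) \in edges X.
Proof. by rewrite merge_pairsE => /andP[]. Qed.

Lemma fixed_vertsP u : u \in fixed_verts X <->
  [/\ u \in verts X, u \notin split_verts X,
      forall v, (u, v) \notin merge_pairs X & forall v, (v, u) \notin merge_pairs X].
Proof.
rewrite inE; split.
  case/and4P=> uV uS u1 u2; split=> // v; apply/negP => uv.
    by case/imfsetP: u1; exists (u, v).
  by case/imfsetP: u2; exists (v, u).
case=> uV uS u1 u2; apply/and4P; split=> //.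
  by apply/imfsetP => -[[u' v] /= uv uu']; have := u1 v; rewrite uu' uv.
by apply/imfsetP => -[[v u'] /= uv uu']; have := u2 v; rewrite uu' uv.
Qed.

Lemma fixed_vert u : u \in fixed_verts X -> u \in verts X.
Proof. by case/fixed_vertsP. Qed.

Lemma split_vert u : u \in split_verts X -> u \in verts X.
Proof. by rewrite split_vertsE => /andP[/aV]. Qed.

Lemma merge_fst u v : (u, v) \in merge_pairs X -> u \in verts X.
Proof. by move/merge_edge/(cyc_fst cX). Qed.

Lemma merge_snd u v : (u, v) \in merge_pairs X -> v \in verts X.
Proof. by move/merge_edge/(cyc_snd cX). Qed.

(** From here to [fst_snd]: the four kinds of old vertex exclude one another. A split vertex carries
    both bits, the left member of a pair only the a-bit, the right member only the b-bit, and a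
    fixed vertex is by definition none of these. *)
Lemma fixed_split u : u \in fixed_verts X -> u \in split_verts X -> False.
Proof. by case/fixed_vertsP=> _ /negP. Qed.

Lemma fixed_fst u v : u \in fixed_verts X -> (u, v) \in merge_pairs X -> False.
Proof. by case/fixed_vertsP=> _ _ /(_ v)/negP. Qed.

Lemma fixed_snd u v : u \in fixed_verts X -> (v, u) \in merge_pairs X -> False.
Proof. by case/fixed_vertsP=> _ _ _ /(_ v)/negP. Qed.

Lemma split_fst u v : u \in split_verts X -> (u, v) \in merge_pairs X -> False.
Proof. by rewrite split_vertsE merge_pairsE => /andP[_ ->]; rewrite !andbF. Qed.

Lemma split_snd u v : u \in split_verts X -> (v, u) \in merge_pairs X -> False.
Proof. by rewrite split_vertsE merge_pairsE => /andP[->]; rewrite !andbF. Qed.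

Lemma fst_snd u v w : (u, v) \in merge_pairs X -> (w, u) \in merge_pairs X -> False.
Proof. by rewrite !merge_pairsE => /and5P[_ _ /negPf-> _ _]; rewrite !andbF. Qed.

Lemma vert_cases u : u \in verts X ->
  [\/ u \in fixed_verts X, u \in split_verts X,
      exists v, (u, v) \in merge_pairs X | exists v, (v, u) \in merge_pairs X].
Proof.
move=> uV; have [uS|uS] := boolP (u \in split_verts X); first by constructor 2.
have [u1|u1] := pselect (exists v, (u, v) \in merge_pairs X); first by constructor 3.
have [u2|u2] := pselect (exists v, (v, u) \in merge_pairs X); first by constructor 4.
constructor 1; apply/fixed_vertsP; split=> // v; apply/negP => uv.
  by apply: u1; exists v.
by apply: u2; exists v.
Qed.

Lemma heir_a_split u : u \in split_verts X -> heir_a X u = nl u.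
Proof. by rewrite /heir_a => ->. Qed.

Lemma heir_b_split u : u \in split_verts X -> heir_b X u = nr u.
Proof. by rewrite /heir_b => ->. Qed.

(** The [pick] has a single candidate, because [u] has one outgoing edge. *)
Lemma heir_a_merge u v : (u, v) \in merge_pairs X -> heir_a X u = njoin u v.
Proof.
move=> uv; rewrite /heir_a; case: ifP => [/split_fst/(_ uv)//|_].
case: pickP => [[[u' v'] /= uv'] /eqP uu'|/(_ (FSetSub uv))/=]; last by rewrite eqxx.
by rewrite /= in uu'; rewrite uu' in uv' *; rewrite (cyc_out_uniq cX (merge_edge uv) (merge_edge uv')).
Qed.

Lemma heir_b_merge u v : (u, v) \in merge_pairs X -> heir_b X v = njoin u v.
Proof.
move=> uv; rewrite /heir_b; case: ifP => [/split_snd/(_ uv)//|_].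
case: pickP => [[[u' v'] /= uv'] /eqP uu'|/(_ (FSetSub uv))/=]; last by rewrite eqxx.
by rewrite /= in uu'; rewrite uu' in uv' *; rewrite (cyc_in_uniq cX (merge_edge uv) (merge_edge uv')).
Qed.

Lemma heir_a_fixed u : u \in fixed_verts X -> heir_a X u = u.
Proof.
move=> uF; rewrite /heir_a; case: ifP => [/(fixed_split uF)//|_].
case: pickP => [[[u' v'] /= uv'] /eqP uu'|//].
by rewrite /= in uu'; rewrite uu' in uv'; case: (fixed_fst uF uv').
Qed.

Lemma heir_b_fixed u : u \in fixed_verts X -> heir_b X u = u.
Proof.
move=> uF; rewrite /heir_b; case: ifP => [/(fixed_split uF)//|_].
case: pickP => [[[v' u'] /= uv'] /eqP uu'|//].
by rewrite /= in uu'; rewrite uu' in uv'; case: (fixed_snd uF uv').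
Qed.

Inductive new_vert : name K -> Prop :=
| NewFixed u of u \in fixed_verts X : new_vert u
| NewMerged u v of (u, v) \in merge_pairs X : new_vert (njoin u v)
| NewLeft u of u \in split_verts X : new_vert (nl u)
| NewRight u of u \in split_verts X : new_vert (nr u).

Lemma split_merge_vertsP n : n \in verts (split_merge X) <-> new_vert n.
Proof.
rewrite !in_fsetU; split; last first.
  case=> [u uF|u v uv|u uS|u uS].
  - by rewrite uF.
  - suff -> : njoin u v \in [fset njoin e.1 e.2 | e in merge_pairs X] by rewrite orbT.
    by apply/imfsetP; exists (u, v).
  - suff -> : nl u \in [fset nl u | u in split_verts X] by rewrite orbT.
    by apply/imfsetP; exists u.
  - suff -> : nr u \in [fset nr u | u in split_verts X] by rewrite orbT.
    by apply/imfsetP; exists u.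
case/orP=> [/orP[/orP[nF|/imfsetP[[u v] uv ->]]|/imfsetP[u uS ->]]|/imfsetP[u uS ->]].
- exact: NewFixed.
- exact: NewMerged.
- exact: NewLeft.
- exact: NewRight.
Qed.

Lemma njoin_notin u v : (u, v) \in merge_pairs X -> njoin u v \notin verts X.
Proof. by move=> uv; apply/negP => /(njoin_neq indX (merge_fst uv)); apply. Qed.

Lemma nl_notin u : u \in split_verts X -> nl u \notin verts X.
Proof. by move=> uS; apply/negP => /(nl_neq indX (split_vert uS)); apply. Qed.

Lemma nr_notin u : u \in split_verts X -> nr u \notin verts X.
Proof. by move=> uS; apply/negP => /(nr_neq indX (split_vert uS)); apply. Qed.

Lemma split_merge_aP n : n \in abits (split_merge X) <->
  [\/ n \in abits X /\ n \in fixed_verts X,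
      exists u v, (u, v) \in merge_pairs X /\ n = njoin u v |
      exists u, u \in split_verts X /\ n = nl u].
Proof.
rewrite !in_fsetU in_fsetI; split.
  case/orP=> [/orP[/andP|/imfsetP[[u v] uv ->]]|/imfsetP[u uS ->]].
  - by constructor 1.
  - by constructor 2; exists u, v.
  - by constructor 3; exists u.
case=> [[-> ->]//|[u [v [uv ->]]]|[u [uS ->]]].
- by apply/orP; left; apply/orP; right; apply/imfsetP; exists (u, v).
- by apply/orP; right; apply/imfsetP; exists u.
Qed.

Lemma split_merge_bP n : n \in bbits (split_merge X) <->
  [\/ n \in bbits X /\ n \in fixed_verts X,
      exists u v, (u, v) \in merge_pairs X /\ n = njoin u v |
      exists u, u \in split_verts X /\ n = nr u].
Proof.
rewrite !in_fsetU in_fsetI; split.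
  case/orP=> [/orP[/andP|/imfsetP[[u v] uv ->]]|/imfsetP[u uS ->]].
  - by constructor 1.
  - by constructor 2; exists u, v.
  - by constructor 3; exists u.
case=> [[-> ->]//|[u [v [uv ->]]]|[u [uS ->]]].
- by apply/orP; left; apply/orP; right; apply/imfsetP; exists (u, v).
- by apply/orP; right; apply/imfsetP; exists u.
Qed.

(** A fixed vertex with both bits would have been split, and each half of a split vertex has one
    bit. *)
Lemma split_merge_ab n : n \in abits (split_merge X) ->
  n \in bbits (split_merge X) ->
  exists u v, (u, v) \in merge_pairs X /\ n = njoin u v.
Proof.
move=> /split_merge_aP[[na nF]|//|[u [uS nu]]] /split_merge_bP[[nb nF']|//|[v [vS nv]]].
- by case: (fixed_split nF); rewrite split_vertsE na nb.
- by have := nr_notin vS; rewrite -nv (fixed_vert nF).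
- by have := nl_notin uS; rewrite -nu (fixed_vert nF').
- by case: (nl_neq_nr indX (split_vert uS) (split_vert vS)); rewrite -nu.
Qed.

Lemma split_merge_edgesP n m : (n, m) \in edges (split_merge X) <->
  (exists u v, [/\ (u, v) \in edges X, (u, v) \notin merge_pairs X,
     n = heir_b X u & m = heir_a X v]) \/
  exists2 u, u \in split_verts X & n = nl u /\ m = nr u.
Proof.
rewrite in_fsetU; split.
  case/orP=> [/imfsetP[[u v]]|/imfsetP[u /= uS [-> ->]]]; last by right; exists u.
  by rewrite in_fsetD => /andP[uvM uv] [-> ->]; left; exists u, v.
case=> [[u [v [uv uvM -> ->]]]|[u uS [-> ->]]]; apply/orP; [left|right]; apply/imfsetP.
  by exists (u, v); rewrite // in_fsetD uvM.
by exists u.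
Qed.

(** The graph of [heir_b] on the vertices whose port b survives: left members of merged pairs, where
    [heir_b] takes a default value, are left out. [in_port] is the mirror image for [heir_a]. *)
Inductive out_port : name K -> name K -> Prop :=
| OutFixed u of u \in fixed_verts X : out_port u u
| OutMerged u v of (u, v) \in merge_pairs X : out_port v (njoin u v)
| OutSplit u of u \in split_verts X : out_port u (nr u).

Inductive in_port : name K -> name K -> Prop :=
| InFixed u of u \in fixed_verts X : in_port u u
| InMerged u v of (u, v) \in merge_pairs X : in_port u (njoin u v)
| InSplit u of u \in split_verts X : in_port u (nl u).

Lemma heir_b_port u v : (u, v) \in edges X -> (u, v) \notin merge_pairs X ->
  out_port u (heir_b X u).
Proof.
move=> uv uvM; case: (vert_cases (cyc_fst cX uv)) => [uF|uS|[w uw]|[w wu]].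
- by rewrite heir_b_fixed //; constructor.
- by rewrite heir_b_split //; constructor.
- by case/negP: uvM; rewrite (cyc_out_uniq cX uv (merge_edge uw)).
- by rewrite (heir_b_merge wu); constructor.
Qed.

Lemma heir_a_port u v : (u, v) \in edges X -> (u, v) \notin merge_pairs X ->
  in_port v (heir_a X v).
Proof.
move=> uv uvM; case: (vert_cases (cyc_snd cX uv)) => [uF|uS|[w uw]|[w wu]].
- by rewrite heir_a_fixed //; constructor.
- by rewrite heir_a_split //; constructor.
- by rewrite (heir_a_merge uw); constructor.
- by case/negP: uvM; rewrite (cyc_in_uniq cX uv (merge_edge wu)).
Qed.

(** Independence of the old names keeps old vertices, joins and halves apart; this yields uniqueness
    of outgoing edges after the step. *)
Lemma out_port_inj u u' n n' : out_port u n -> out_port u' n' -> n = n' -> u = u'.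
Proof.
case=> [{}u uF|v {}u uv|{}u uS] [{}u' uF'|v' {}u' uv'|{}u' uS'] //.
- by move=> h; have := njoin_notin uv'; rewrite -h (fixed_vert uF).
- by move=> h; have := nr_notin uS'; rewrite -h (fixed_vert uF).
- by move=> h; have := njoin_notin uv; rewrite h (fixed_vert uF').
- by case/njoin_inj.
- by move/(njoin_neq_nr indX (merge_fst uv) (split_vert uS')).
- by move=> h; have := nr_notin uS; rewrite h (fixed_vert uF').
- by move/esym/(njoin_neq_nr indX (merge_fst uv') (split_vert uS)).
- by move/(nr_inj indX (split_vert uS) (split_vert uS')).
Qed.

Lemma in_port_inj u u' n n' : in_port u n -> in_port u' n' -> n = n' -> u = u'.
Proof.
case=> [{}u uF|{}u v uv|{}u uS] [{}u' uF'|{}u' v' uv'|{}u' uS'] //.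
- by move=> h; have := njoin_notin uv'; rewrite -h (fixed_vert uF).
- by move=> h; have := nl_notin uS'; rewrite -h (fixed_vert uF).
- by move=> h; have := njoin_notin uv; rewrite h (fixed_vert uF').
- by case/njoin_inj.
- by move/(njoin_neq_nl indX (merge_fst uv) (split_vert uS')).
- by move=> h; have := nl_notin uS; rewrite h (fixed_vert uF').
- by move/esym/(njoin_neq_nl indX (merge_fst uv') (split_vert uS)).
- by move/(nl_inj indX (split_vert uS) (split_vert uS')).
Qed.

(** Port b of a left half is thus used by the inner edge of the split vertex alone. *)
Lemma out_port_nl u n w : out_port u n -> w \in split_verts X -> n <> nl w.
Proof.
case=> [{}u uF|v {}u uv|{}u uS] wS.
- by move=> h; have := nl_notin wS; rewrite -h (fixed_vert uF).
- exact: njoin_neq_nl indX (merge_fst uv) (split_vert wS).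
- by move/esym/(nl_neq_nr indX (split_vert wS) (split_vert uS)).
Qed.

Lemma in_port_nr u n w : in_port u n -> w \in split_verts X -> n <> nr w.
Proof.
case=> [{}u uF|{}u v uv|{}u uS] wS.
- by move=> h; have := nr_notin wS; rewrite -h (fixed_vert uF).
- exact: njoin_neq_nr indX (merge_fst uv) (split_vert wS).
- exact: nl_neq_nr indX (split_vert uS) (split_vert wS).
Qed.

(** A letter after a half extends the word that selects this half in the old vertex; a letter after
    a join selects one of the two members and leaves the empty word. *)
Inductive split_merge_code : name K -> dir -> name K -> word -> Prop :=
| CodeFixed u x of u \in fixed_verts X : split_merge_code u x u [:: x]
| CodeLeft u x of u \in split_verts X : split_merge_code (nl u) x u [:: dl; x]
| CodeRight u x of u \in split_verts X : split_merge_code (nr u) x u [:: dr; x]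
| CodeMergeL u v of (u, v) \in merge_pairs X : split_merge_code (njoin u v) dl u [::]
| CodeMergeR u v of (u, v) \in merge_pairs X : split_merge_code (njoin u v) dr v [::].

Lemma split_merge_independent : independent (verts (split_merge X)).
Proof.
apply: (independent_recode (code := split_merge_code) indX).
  move=> n x /split_merge_vertsP[u uF|u v uv|u uS|u uS].
  - by exists u, [:: x]; split=> //; [constructor | exact: fixed_vert].
  - case: x; [exists u, [::] | exists v, [::]]; split=> //.
    + exact: CodeMergeL.
    + exact: merge_fst uv.
    + by move=> t; rewrite napp_joinl.
    + exact: CodeMergeR.
    + exact: merge_snd uv.
    + by move=> t; rewrite napp_joinr.
  - exists u, [:: dl; x]; split=> //; [exact: CodeLeft | exact: split_vert |].
    by move=> t; rewrite napp_nl.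
  - exists u, [:: dr; x]; split=> //; [exact: CodeRight | exact: split_vert |].
    by move=> t; rewrite napp_nr.
move=> n m x y u w w' t s c; move: c m y w'.
case=> {n x u w} [u x uF|u x uS|u x uS|u v uv|u v uv] m y w' c;
  inversion c as [u' y' uF'|u' y' uS'|u' y' uS'|u' v' uv'|v' u' uv'];
  subst; try by [move=> []; try move=> ->; case: (fixed_split uF uS')].
(* Both codes refer to the same old vertex, so mixed cases contradict the exclusion of kinds. The
   two halves of a split vertex differ in the first letter, and for two joins the common member
   determines its partner. *)
all: try by case: (fixed_split uF uS').
all: try by case: (fixed_split uF' uS).
all: try by case: (fixed_fst uF uv').
all: try by case: (fixed_snd uF uv').
all: try by case: (fixed_fst uF' uv).
all: try by case: (fixed_snd uF' uv).
all: try by case: (split_fst uS uv').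
all: try by case: (split_snd uS uv').
all: try by case: (split_fst uS' uv).
all: try by case: (split_snd uS' uv).
all: try by case: (fst_snd uv uv').
all: try by case: (fst_snd uv' uv).
all: try by case=> ->.
all: try by case.
- by rewrite (cyc_out_uniq cX (merge_edge uv) (merge_edge uv')).
- by rewrite (cyc_in_uniq cX (merge_edge uv) (merge_edge uv')).
Qed.

Lemma split_merge_cyclic : cyclic (split_merge X).
Proof.
split; first exact: split_merge_independent.
- move=> n m /split_merge_edgesP[[u [v [uv uvM -> _]]]|[u uS [-> _]]]; apply/split_merge_vertsP.
    by case: (heir_b_port uv uvM) => *; constructor.
  exact: NewLeft.
- move=> n m /split_merge_edgesP[[u [v [uv uvM _ ->]]]|[u uS [_ ->]]]; apply/split_merge_vertsP.
    by case: (heir_a_port uv uvM) => *; constructor.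
  exact: NewRight.
- move=> n /split_merge_vertsP nV.
  have heir u v : (u, v) \in edges X -> (u, v) \notin merge_pairs X ->
      exists m, (heir_b X u, m) \in edges (split_merge X).
    by move=> uv uvM; exists (heir_a X v); apply/split_merge_edgesP; left; exists u, v.
  case: nV => [u uF|u v uv|u uS|u uS].
  + have [v uv] := cyc_out cX (fixed_vert uF).
    have := heir _ _ uv; rewrite (heir_b_fixed uF); apply; apply/negP.
    exact: fixed_fst uF.
  + have [w vw] := cyc_out cX (merge_snd uv).
    rewrite -(heir_b_merge uv); apply: heir vw _; apply/negP => vw'.
    exact: fst_snd vw' uv.
  + by exists (nr u); apply/split_merge_edgesP; right; exists u.
  + have [w uw] := cyc_out cX (split_vert uS).
    rewrite -(heir_b_split uS); apply: heir uw _; apply/negP.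
    exact: split_fst uS.
- move=> n m m' /split_merge_edgesP[[u [v [uv uvM -> ->]]]|[u uS [-> ->]]];
  move=> /split_merge_edgesP[[u' [v' [uv' uvM' h ->]]]|[u' uS' [h ->]]].
  + have uu' := out_port_inj (heir_b_port uv uvM) (heir_b_port uv' uvM') h.
    by subst u'; rewrite (cyc_out_uniq cX uv uv').
  + by case: (out_port_nl (heir_b_port uv uvM) uS' h).
  + by case: (out_port_nl (heir_b_port uv' uvM') uS (esym h)).
  + by rewrite (nl_inj indX (split_vert uS) (split_vert uS') h).
- move=> m n n' /split_merge_edgesP[[u [v [uv uvM -> ->]]]|[u uS [-> ->]]];
  move=> /split_merge_edgesP[[u' [v' [uv' uvM' -> h]]]|[u' uS' [-> h]]].
  + have vv' := in_port_inj (heir_a_port uv uvM) (heir_a_port uv' uvM') h.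
    by subst v'; rewrite (cyc_in_uniq cX uv uv').
  + by case: (in_port_nr (heir_a_port uv uvM) uS' h).
  + by case: (in_port_nr (heir_a_port uv' uvM') uS (esym h)).
  + by rewrite (nr_inj indX (split_vert uS) (split_vert uS') h).
- apply/fsubsetP => n /split_merge_aP h; apply/split_merge_vertsP.
  by case: h => [[]|[u [v [uv ->]]]|[u [uS ->]]]; constructor.
- apply/fsubsetP => n /split_merge_bP h; apply/split_merge_vertsP.
  by case: h => [[]|[u [v [uv ->]]]|[u [uS ->]]]; constructor.
Qed.

Let fsts := [fset e.1 | e in merge_pairs X].
Let snds := [fset e.2 | e in merge_pairs X].
Let merged := [fset njoin e.1 e.2 | e in merge_pairs X].
Let lhalves := [fset nl u | u in split_verts X].
Let rhalves := [fset nr u | u in split_verts X].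

Lemma card_fsts : #|` fsts| = #|` merge_pairs X|.
Proof.
apply/card_in_imfset => -[u v] [u' v'] /= uv uv' uu'.
by rewrite uu' in uv *; rewrite (cyc_out_uniq cX (merge_edge uv) (merge_edge uv')).
Qed.

Lemma card_snds : #|` snds| = #|` merge_pairs X|.
Proof.
apply/card_in_imfset => -[u v] [u' v'] /= uv uv' vv'.
by rewrite vv' in uv *; rewrite (cyc_in_uniq cX (merge_edge uv) (merge_edge uv')).
Qed.

Lemma card_merged : #|` merged| = #|` merge_pairs X|.
Proof.
by apply/card_in_imfset => -[u v] [u' v'] /= uv uv' /njoin_inj[-> ->].
Qed.

Lemma card_lhalves : #|` lhalves| = #|` split_verts X|.
Proof.
apply/card_in_imfset => u v /= uS vS.
exact: nl_inj indX (split_vert uS) (split_vert vS).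
Qed.

Lemma card_rhalves : #|` rhalves| = #|` split_verts X|.
Proof.
apply/card_in_imfset => u v /= uS vS.
exact: nr_inj indX (split_vert uS) (split_vert vS).
Qed.

Lemma fstsP u : u \in fsts <-> exists v, (u, v) \in merge_pairs X.
Proof.
split=> [/imfsetP[[u' v] /= uv ->]|[v uv]]; first by exists v.
by apply/imfsetP; exists (u, v).
Qed.

Lemma sndsP u : u \in snds <-> exists v, (v, u) \in merge_pairs X.
Proof.
split=> [/imfsetP[[v u'] /= uv ->]|[v uv]]; first by exists v.
by apply/imfsetP; exists (v, u).
Qed.

(** With [F] fixed vertices, [M] pairs and [S] split vertices, the count goes from [F + 2M + S] to
    [F + M + 2S]. *)
Lemma card_split_merge_verts :
  (#|` verts (split_merge X)| + #|` merge_pairs X| =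
   #|` verts X| + #|` split_verts X|)%N.
Proof.
have -> : verts X = fixed_verts X `|` fsts `|` snds `|` split_verts X.
  apply/fsetP => u; rewrite !in_fsetU; apply/idP/idP.
    case/vert_cases=> [->//|->|/(iffRL (fstsP _))->|/(iffRL (sndsP _))->]; by rewrite ?orbT.
  case/orP=> [/orP[/orP[/fixed_vert//|/fstsP[v /merge_fst//]]|/sndsP[v /merge_snd//]]|].
  exact: split_vert.
rewrite !card_fsetU_disjoint ?card_fsts ?card_snds ?card_merged ?card_lhalves ?card_rhalves.
- lia.
- move=> u uF /imfsetP[[v w] /= vw uvw]; have := njoin_notin vw.
  by rewrite -uvw (fixed_vert uF).
- move=> u /fsetUP[uF|/imfsetP[[v w] /= vw ->]] /imfsetP[x /= xS ux].
    by have := nl_notin xS; rewrite -ux (fixed_vert uF).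
  exact: njoin_neq_nl indX (merge_fst vw) (split_vert xS) ux.
- move=> u /fsetUP[/fsetUP[uF|/imfsetP[[v w] /= vw ->]]|/imfsetP[y /= yS ->]] /imfsetP[x /= xS ux].
  + by have := nr_notin xS; rewrite -ux (fixed_vert uF).
  + exact: njoin_neq_nr indX (merge_fst vw) (split_vert xS) ux.
  + exact: nl_neq_nr indX (split_vert yS) (split_vert xS) ux.
- by move=> u uF /fstsP[v]; exact: fixed_fst uF.
- by move=> u /fsetUP[uF|/fstsP[w uw]] /sndsP[v]; [exact: fixed_snd uF | exact: fst_snd uw].
- move=> u /fsetUP[/fsetUP[uF|/fstsP[w uw]]|/sndsP[w wu]] uS.
  + exact: fixed_split uF uS.
  + exact: split_fst uS uw.
  + exact: split_snd uS wu.
Qed.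

(** The particle of the left member of a pair goes to the join and that of a split vertex to its
    left half, so three pieces match one by one. *)
Lemma card_split_merge_abits : #|` abits (split_merge X)| = #|` abits X|.
Proof.
have -> : abits X = abits X `&` fixed_verts X `|` fsts `|` split_verts X.
  apply/fsetP => u; rewrite !in_fsetU in_fsetI; apply/idP/idP.
    move=> ua; have [->|->|/(iffRL (fstsP _))->|[v]] := vert_cases (aV ua); rewrite ?ua ?orbT //.
    by rewrite merge_pairsE ua !andbF.
  case/orP=> [/orP[/andP[]//|/fstsP[v]]|]; last by rewrite split_vertsE => /andP[].
  by rewrite merge_pairsE => /and3P[].
rewrite !card_fsetU_disjoint ?card_fsts ?card_merged ?card_lhalves //.
- move=> u /fsetIP[_ uF] /imfsetP[[v w] /= vw uvw]; have := njoin_notin vw.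
  by rewrite -uvw (fixed_vert uF).
- move=> u /fsetUP[/fsetIP[_ uF]|/imfsetP[[v w] /= vw ->]] /imfsetP[x /= xS ux].
    by have := nl_notin xS; rewrite -ux (fixed_vert uF).
  exact: njoin_neq_nl indX (merge_fst vw) (split_vert xS) ux.
- by move=> u /fsetIP[_ uF] /fstsP[v]; exact: fixed_fst uF.
- move=> u /fsetUP[/fsetIP[_ uF]|/fstsP[w uw]] uS.
  + exact: fixed_split uF uS.
  + exact: split_fst uS uw.
Qed.

Lemma card_split_merge_bbits : #|` bbits (split_merge X)| = #|` bbits X|.
Proof.
have -> : bbits X = bbits X `&` fixed_verts X `|` snds `|` split_verts X.
  apply/fsetP => u; rewrite !in_fsetU in_fsetI; apply/idP/idP.
    move=> ub; have uV := fsubsetP (cyc_b cX) u ub.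
    have [->|->|[v]|/(iffRL (sndsP _))->] := vert_cases uV; rewrite ?ub ?orbT //.
    by rewrite merge_pairsE ub !andbF.
  case/orP=> [/orP[/andP[]//|/sndsP[v]]|]; last by rewrite split_vertsE => /andP[].
  by rewrite merge_pairsE => /and5P[].
rewrite !card_fsetU_disjoint ?card_snds ?card_merged ?card_rhalves //.
- move=> u /fsetIP[_ uF] /imfsetP[[v w] /= vw uvw]; have := njoin_notin vw.
  by rewrite -uvw (fixed_vert uF).
- move=> u /fsetUP[/fsetIP[_ uF]|/imfsetP[[v w] /= vw ->]] /imfsetP[x /= xS ux].
    by have := nr_notin xS; rewrite -ux (fixed_vert uF).
  exact: njoin_neq_nr indX (merge_fst vw) (split_vert xS) ux.
- by move=> u /fsetIP[_ uF] /sndsP[v]; exact: fixed_snd uF.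
- move=> u /fsetUP[/fsetIP[_ uF]|/sndsP[w wu]] uS.
  + exact: fixed_split uF uS.
  + exact: split_snd uS wu.
Qed.

Lemma nparticles_split_merge : nparticles (split_merge X) = nparticles X.
Proof. by rewrite /nparticles card_split_merge_abits card_split_merge_bbits. Qed.

Lemma split_merge_id : split_verts X = fset0 -> merge_pairs X = fset0 ->
  split_merge X = X.
Proof.
move=> S0 M0; have fixV u : u \in verts X -> u \in fixed_verts X.
  by move=> /vert_cases[//||[v]|[v]]; rewrite ?S0 ?M0 inE.
have im0 (T T' : choiceType) (f : T -> T') : [fset f x | x in (fset0 : {fset T})] = fset0.
  by apply/fsetP => y; rewrite inE; apply/negP => /imfsetP[x]; rewrite inE.
have FV : fixed_verts X = verts X.
  by apply/eqP; rewrite eqEfsubset; apply/andP; split; apply/fsubsetP => u;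
     [exact: fixed_vert | exact: fixV].
rewrite /split_merge S0 M0 !im0 !fsetU0 FV fsetD0.
rewrite (fsetIidPl (cyc_a cX)) (fsetIidPl (cyc_b cX)).
suff -> : [fset (heir_b X e.1, heir_a X e.2) | e in edges X] = edges X by case: (X).
apply/fsetP => -[n m]; apply/imfsetP/idP => [[[u v] /= uv]|nm].
  by rewrite heir_b_fixed ?heir_a_fixed ?fixV ?(cyc_fst cX uv) ?(cyc_snd cX uv) // => ->.
exists (n, m) => //=.
by rewrite heir_b_fixed ?heir_a_fixed ?fixV ?(cyc_fst cX nm) ?(cyc_snd cX nm).
Qed.

End SplitMerge.

(** * Invariants of the full step and linear growth bound *)

Lemma step_cyclic (K : Type) (X : graph K) : cyclic X -> cyclic (step X).
Proof. by move=> cX; apply/sqrt_tau_cyclic/split_merge_cyclic. Qed.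

Lemma iter_step_cyclic (K : Type) (X : graph K) n : cyclic X -> cyclic (iter n (@step K) X).
Proof. by move=> cX; elim: n => //= n; exact: step_cyclic. Qed.

Lemma card_step_verts (K : Type) (X : graph K) : cyclic X ->
  (#|` verts (step X)| + #|` merge_pairs X| =
   #|` verts X| + #|` split_verts X|)%N.
Proof.
move=> cX; rewrite card_sqrt_tau_verts; last exact: split_merge_cyclic.
exact: card_split_merge_verts.
Qed.

Lemma nparticles_step (K : Type) (X : graph K) : cyclic X ->
  nparticles (step X) = nparticles X.
Proof.
move=> cX; rewrite nparticles_sqrt_tau; last exact: split_merge_cyclic.
exact: nparticles_split_merge.
Qed.

Lemma nparticles_iter_step (K : Type) (X : graph K) n : cyclic X ->
  nparticles (iter n (@step K) X) = nparticles X.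
Proof.
by move=> cX; elim: n => //= n <-; rewrite nparticles_step //; exact: iter_step_cyclic.
Qed.

(** Every split vertex holds a particle, and the number of particles is constant, so one step adds
    at most [nparticles X] vertices. *)
Lemma card_iter_step_le (K : Type) (X : graph K) n : cyclic X ->
  (#|` verts (iter n (@step K) X)| <= #|` verts X| + n * nparticles X)%N.
Proof.
move=> cX; elim: n => [|n IHn]; first by rewrite addn0.
have cn := iter_step_cyclic n cX; have := card_step_verts cn.
have : (#|` split_verts (iter n (@step K) X)| <= nparticles X)%N.
  rewrite -(nparticles_iter_step n cX) /nparticles.
  by apply: leq_trans (leq_addr _ _); exact/fsubset_leq_card/fsubsetIl.
rewrite iterS; lia.
Qed.

(** * Merges come to an end *)

(** Meant for [u] just to the left of a right-moving particle; the stretch extends leftwards from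
    [u]. In a [cyclic] graph the quantified [w] is the only predecessor. *)
Fixpoint clear_behind (K : Type) (X : graph K) (k : nat) (u : name K) : Prop :=
  if k is k'.+1 then u \notin bbits X /\
    forall w, (w, u) \in edges X -> clear_behind X k' w
  else True.

Section Merging.
Variables (K : Type) (X : graph K).
Hypothesis cX : cyclic X.
Implicit Types (u v w : name K).

Lemma clear_behind_walk k l u v : clear_behind X k u -> walk X l v u -> l < k ->
  v \notin bbits X.
Proof.
elim: l k u => [|l IHl] [|k] u //= [ub clr]; first by move=> ->.
move=> vu lk.
(* [walk] unfolds at its first edge but [clear_behind] starts from the far end, so the last edge is
   split off. *)
have [w vw wu] : exists2 w, walk X l v w & (w, u) \in edges X.
  elim: l v vu {IHl lk} => [|l IHl] v [x vx]; first by move=> <-; exists v.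
  by move=> /IHl[w xw wu]; exists w => //; exists x.
exact: IHl (clr w wu) vw lk.
Qed.

(** An edge inherits the b-bit of its source, so a clear stretch pulls back to the sources with the
    same length. *)
Lemma clear_behind_sqrt_tau k u v : (u, v) \in edges X ->
  clear_behind (sqrt_tau X) k (edge_name (u, v)) -> clear_behind X k u.
Proof.
elim: k u v => //= k IHk u v uv [ub clr]; split.
  by rewrite sqrt_tau_bP // in ub.
move=> w wu; apply: (IHk _ _ wu); apply: clr.
by apply/sqrt_tau_edgesP; exists w, u, v.
Qed.

(** Joins and right halves carry a b-bit, so an heir of port b without one is a fixed vertex: the
    stretch consists of unchanged vertices. *)
Lemma clear_behind_split_merge k u v : (u, v) \in edges X ->
  (u, v) \notin merge_pairs X ->
  clear_behind (split_merge X) k (heir_b X u) -> clear_behind X k u.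
Proof.
elim: k u v => //= k IHk u v uv uvM [ub clr].
have port_fixed n : out_port X u n -> n \notin bbits (split_merge X) ->
    u \in fixed_verts X.
  case=> // [w {uv uvM clr ub}u wu|{uv uvM clr ub}u uS] /negP[]; apply/split_merge_bP.
    by constructor 2; exists w, u.
  by constructor 3; exists u.
have uF := port_fixed _ (heir_b_port cX uv uvM) ub.
rewrite heir_b_fixed // in ub clr; split.
  by apply: contra ub => ub; apply/split_merge_bP; constructor 1.
move=> w wu.
have wuM : (w, u) \notin merge_pairs X by apply/negP; exact: fixed_snd uF.
apply: (IHk _ _ wu wuM); apply: clr; apply/split_merge_edgesP; left; exists w, u.
by rewrite heir_a_fixed.
Qed.

End Merging.

(** The bound [k] serves as a potential: traced back in time it grows by one per step, and
    [merging_bound] caps it. *)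
Definition merging (K : Type) (X : graph K) (k : nat) : Prop :=
  exists u v, (u, v) \in merge_pairs X /\ clear_behind X k u.

(* A merge at the next step needs both particles at the same vertex after the
   current [I], that is, at a vertex that [I] has just merged. *)
Lemma merging_step (K : Type) (X : graph K) k : cyclic X ->
  merging (step X) k -> merging X k.+1.
Proof.
move=> cX [n [m [nm clr]]]; have cY := split_merge_cyclic cX.
move: (nm); rewrite merge_pairsE => /and5P[/sqrt_tau_edgesP[u [v [w [uv vw nE mE]]]]].
rewrite nE mE !sqrt_tau_aP // !sqrt_tau_bP //= => va ub vb wa.
have [x [y [xy vE]]] := split_merge_ab cX va vb.
(* The additional unit of length is [x] itself, which has no b-bit; the other [k] vertices start at
   its predecessor. *)
exists x, y; split=> //=; split; first by move: xy; rewrite merge_pairsE => /and5P[].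
move=> z zx; have zxM : (z, x) \notin merge_pairs X by apply/negP; exact: fst_snd xy.
apply: (clear_behind_split_merge cX zx zxM).
have zv : (heir_b X z, v) \in edges (split_merge X).
  by apply/split_merge_edgesP; left; exists z, x; rewrite (heir_a_merge cX xy).
rewrite (cyc_in_uniq cY zv uv).
by apply: (clear_behind_sqrt_tau cY uv); rewrite -nE.
Qed.

(** A longer clear stretch would go round the cycle and reach [v], which has a b-bit. *)
Lemma merging_bound (K : Type) (X : graph K) k : cyclic X ->
  merging X k -> k < #|` verts X|.
Proof.
move=> cX [u [v [uv clr]]]; have [l lN vu] := walk_back cX (merge_edge uv).
rewrite ltnNge; apply/negP => Nk.
have := clear_behind_walk clr vu (leq_trans lN Nk).
by move: uv; rewrite merge_pairsE => /and5P[_ _ _ -> _].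
Qed.

(** A merge at time [n], traced back to time 0, yields a clear stretch of length [n], too long for
    [X]. *)
Lemma merge_pairs_eventually0 (K : Type) (X : graph K) n : cyclic X ->
  #|` verts X| <= n -> merge_pairs (iter n (@step K) X) = fset0.
Proof.
move=> cX Nn; apply/eqP/fset0Pn => -[[u v] uv].
have mX k : merging (iter n (@step K) X) k -> merging X (n + k).
  elim: n k {Nn uv} => //= n IHn k /merging_step h.
  by rewrite addSnnS; apply/IHn/h/iter_step_cyclic.
have /mX/(merging_bound cX) : merging (iter n (@step K) X) 0 by exists u, v.
by rewrite addn0 ltnNge Nn.
Qed.

(** * Meetings of particles and growth of the cycle *)

(** The walk may pass other particles or wrap around; [k] only bounds the time before some split or
    merge. *)
Definition meeting (K : Type) (X : graph K) (k : nat) : Prop :=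
  exists u v, [/\ u \in bbits X, v \in abits X & walk X k u v].

Lemma meeting_sqrt_tau (K : Type) (X : graph K) k : cyclic X ->
  meeting X k.+1 -> meeting (sqrt_tau X) k.
Proof.
move=> cX [u [v [ub va /(sqrt_tau_walk)[x [y [ux yv xy]]]]]].
by exists (edge_name (u, x)), (edge_name (y, v)); rewrite sqrt_tau_bP // sqrt_tau_aP.
Qed.

(** At distance 0 the two particles cross, and the next walk from the right-moving to the
    left-moving one goes round the cycle. *)
Lemma meeting_sqrt_tau_lt (K : Type) (X : graph K) k : cyclic X ->
  meeting X k -> k < #|` verts X| ->
  exists2 l, l < #|` verts X| & meeting (sqrt_tau X) l.
Proof.
move=> cX; case: k => [[u [v [ub ua uv]]] _|k Xk kN]; last first.
  by exists k; [exact: ltnW | exact: meeting_sqrt_tau].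
rewrite /= in uv; subst v; have uV := fsubsetP (cyc_a cX) u ua.
have [v uv] := cyc_out cX uV; have [w wu] := cyc_in cX uV.
have : (edge_name (w, u), edge_name (u, v)) \in edges (sqrt_tau X).
  by apply/sqrt_tau_edgesP; exists w, u, v.
case/(walk_back (sqrt_tau_cyclic cX)) => l; rewrite card_sqrt_tau_verts // => lN uvwu.
by exists l => //; exists (edge_name (u, v)), (edge_name (w, u)); rewrite sqrt_tau_bP // sqrt_tau_aP.
Qed.

(** If nothing splits or merges, [split_merge] is the identity and [sqrt_tau] shortens the walk;
    [k = 0] is excluded, since a vertex with both bits splits. Otherwise the old walk is discarded
    for one between the two particles of a split or merged vertex. *)
Lemma meeting_step (K : Type) (X : graph K) k : cyclic X -> meeting X k ->
  [/\ split_verts X = fset0, merge_pairs X = fset0, 0 < k & meeting (step X) k.-1]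
  \/ (split_verts X != fset0 \/ merge_pairs X != fset0) /\
     exists2 l, l < #|` verts (step X)| & meeting (step X) l.
Proof.
move=> cX Xk; have cY := split_merge_cyclic cX.
have [S0|/fset0Pn[u uS]] := eqVneq (split_verts X) fset0; last first.
  right; split; first by left.
  rewrite card_sqrt_tau_verts //.
  have nlr : (nl u, nr u) \in edges (split_merge X).
    by apply/split_merge_edgesP; right; exists u.
  have [l lN rl] := walk_back cY nlr; apply: (meeting_sqrt_tau_lt cY) lN.
  exists (nr u), (nl u); split=> //.
    by apply/split_merge_bP; constructor 3; exists u.
  by apply/split_merge_aP; constructor 3; exists u.
have [M0|/fset0Pn[[u v] uv]] := eqVneq (merge_pairs X) fset0; last first.
  right; split; first by right.
  rewrite card_sqrt_tau_verts //; apply: (@meeting_sqrt_tau_lt _ _ 0) => //.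
    exists (njoin u v), (njoin u v); split=> //.
      by apply/split_merge_bP; constructor 2; exists u, v.
    by apply/split_merge_aP; constructor 2; exists u, v.
  have : njoin u v \in verts (split_merge X).
    by apply/(split_merge_vertsP X); constructor.
  by rewrite lt0n cardfs_eq0; apply: contraL => /eqP->; rewrite inE.
left; rewrite /step split_merge_id //; case: k Xk => [[u [v [ub ua uv]]]|k Xk].
  by rewrite /= in uv; subst v; have := split_vertsE X u; rewrite S0 ua ub inE.
by split=> //; exact: meeting_sqrt_tau.
Qed.

(* Once merges are over, [n + r - N ^ 2] cannot increase, where [N] is the number
   of vertices and [r] a distance from a right-moving to a left-moving particle:
   [r] decreases by one at each step until they meet, and a meeting increases
   [N] while resetting [r] below [N]. *)
Lemma card_iter_step_ge (K : Type) (X : graph K) k : cyclic X -> meeting X k ->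
  exists c, forall n, (n <= #|` verts (iter n (@step K) X)| ^ 2 + c)%N.
Proof.
move=> cX Xk; set T := #|` verts X|.
have [r Xr] : exists r, meeting (iter T (@step K) X) r.
  elim: T => [|n [l Xl]]; first by exists k.
  by have [[_ _ _ h]|[_ [l' _ h]]] := meeting_step (iter_step_cyclic n cX) Xl;
    [exists l.-1 | exists l'].
(* [T] covers the times up to [T], while merges may occur; afterwards [n = m + T], and [r] is the
   distance at time [T]. *)
exists (T + r)%N => n.
have [nT|Tn] := leqP n T; first by lia.
rewrite -(subnK (ltnW Tn)); move: (n - T)%N => {Tn}m {n}.
suff [l _] : exists2 l, meeting (iter (m + T) (@step K) X) l &
  (m + l <= #|` verts (iter (m + T) (@step K) X)| ^ 2 + r)%N by lia.
elim: m => [|m [l Xl IHm]]; first by exists r => //; lia.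
have cm := iter_step_cyclic (m + T)%N cX; have := card_step_verts cm.
have M0 := merge_pairs_eventually0 cX (leq_addl m T).
rewrite M0 cardfs0 addn0 addSn iterS; set Z := iter _ _ _ in M0 cm Xl IHm * => cardZ.
have [[S0 _ l0 Zl]|[SM [l' l'N Zl]]] := meeting_step cm Xl.
  by exists l.-1 => //; move: cardZ; rewrite S0 cardfs0 addn0 => ->; lia.
have S1 : 0 < #|` split_verts Z|.
  by case: SM; rewrite ?M0 ?eqxx // lt0n cardfs_eq0.
(* With [N' >= N + 1] and [l' < N'], one has [N ^ 2 + 1 + l' <= N ^ 2 + N' <= N' ^ 2]. *)
by exists l' => //; nia.
Qed.

(** * Binomial estimates and conclusion *)

(** Pascal's rule, starting from ['C(m, 1) = m]. *)
Lemma leq_bin_addr m p : m <= 'C(m + p, p.+1).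
Proof.
elim: p => [|p IHp]; first by rewrite addn0 bin1.
by rewrite addnS binS; apply: leq_trans IHp _; exact: leq_addl.
Qed.

(** Times the factorial of [p], the binomial is a falling factorial, a product of [p] factors at
    most [n]. *)
Lemma bin_leq_expn n p : 'C(n, p) <= n ^ p.
Proof.
apply: leq_trans (leq_pmulr _ (fact_gt0 p)) _; rewrite bin_ffact.
elim: p n => [|p IHp] [|n] //; rewrite ffactnS expnS leq_mul2l /=.
by apply: leq_trans (IHp n) _; case: p {IHp} => // p; rewrite leq_exp2r.
Qed.

Theorem corollary1 (R : realType) (K : countType) (X : graph K)
  (hX : circular X)
  (ha : exists u : name K, u \in verts X /\ u \in abits X)
  (hb : exists v : name K, v \in verts X /\ v \in bbits X) :
  is_Theta (fun n : nat => entropy R (iter n (@step K) X))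
           (fun n : nat => ln (n%:R : R)%R).
Proof.
have cX := circular_cyclic hX.
have [[u [uV ua]] [v [vV vb]]] := (ha, hb).
have [k vu] := circular_walk hX vV uV.
have [c Nge] : exists c, forall n, (n <= #|` verts (iter n (@step K) X)| ^ 2 + c)%N.
  by apply: (@card_iter_step_ge _ _ k cX); exists v, u.
have p0 : (0 < nparticles X)%N.
  by rewrite addn_gt0 lt0n cardfs_eq0; apply/orP; left; apply/fset0Pn; exists u.
set p := nparticles X in p0; set N0 := #|` verts X|.
(* With [M] vertices at time [n], the summand [2 * c] gives [n <= 2 * M ^ 2], which [4] turns into
   [n <= M ^ 4]; [2 * p ^ 2] gives [p <= M], and [2 * (N0 + p)] gives [2 * M <= n ^ 2]. *)
pose n0 := (4 + 2 * c + 2 * p ^ 2 + 2 * (N0 + p))%N.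
(* The constants come from [n <= M ^ 4] with [M <= 'C(2 * M, p)], and from ['C(2 * M, p) <= (2 * M)
   ^ p <= n ^ (2 * p)]. *)
exists (4^-1)%R, (2 * p)%:R%R, n0; split; first by rewrite invr_gt0.
split; first by rewrite ltr0n muln_gt0.
move=> n n0n; rewrite /entropy (nparticles_iter_step _ cX) -/p.
move: (card_iter_step_le n cX) (Nge n); rewrite -/p -/N0.
move: #|` verts (iter n _ X)| => M Mle Mge.
have [n1 n4 nc np nN] : [/\ 0 < n, 4 <= n, 2 * c <= n, 2 * p ^ 2 <= n
    & 2 * (N0 + p) <= n]%N by rewrite /n0 in n0n; split; lia.
have nM : (n <= 2 * M ^ 2)%N by lia.
have Mlow : (n <= M ^ 4)%N.
  (* Multiplied by [n]: [n ^ 2 <= 4 * M ^ 4 <= n * M ^ 4], as [4 <= n]. *)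
  by rewrite (expnM M 2 2) -(leq_pmul2l n1); nia.
have pM : (p <= M)%N by rewrite -(@leq_exp2r _ _ 2) //; lia.
have M2 : (2 * M <= n ^ 2)%N by nia.
have MC : (M <= 'C(2 * M, p))%N.
  apply: (@leq_trans (2 * M - p.-1)); first by lia.
  have := leq_bin_addr (2 * M - p.-1) p.-1; rewrite prednK // subnK //; lia.
have Cn : ('C(2 * M, p) <= n ^ (2 * p))%N.
  by rewrite expnM; apply: leq_trans (bin_leq_expn _ _) _; rewrite leq_exp2r.
have M1 : (0 < M)%N by lia.
have C1 : (0 < 'C(2 * M, p))%N by lia.
have lnM (a b : nat) : (0 < a)%N -> (a <= b)%N -> (ln (a%:R : R) <= ln (b%:R : R))%R.
  by move=> a0 ab; rewrite ler_ln ?posrE ?ltr0n ?ler_nat //; exact: leq_trans ab.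
split.
  rewrite mulrC ler_pdivrMr // mulr_natr.
  apply: le_trans (lnM _ _ n1 Mlow) _.
  by rewrite natrX lnXn ?ltr0n // lerMn2r /= lnM.
apply: le_trans (lnM _ _ C1 Cn) _.
by rewrite natrX lnXn ?ltr0n // mulr_natl.
Qed.
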